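(* Let $f\colon X\to X$ be a surjection. If $(X,f)$ is a nontrivial equicontinuous dynamical system, then $f$ does not have the $\overline{d}$-shadowing property.
   Context: $\mathbb{N}_0=\{0,1,2,\dots\}$. A dynamical system $(X,f)$ is a compact metric space $(X,d)$ together with a continuous map $f\colon X\to X$; it is nontrivial if $X$ has at least two points. $f$ is equicontinuous if for every $\varepsilon>0$ there is $\delta>0$ such that $d(x,y)<\delta$ implies $d(f^n(x),f^n(y))<\varepsilon$ for all $n\in\mathbb{N}_0$. For $A\subset\mathbb{N}_0$, $\overline{d}(A)=\limsup_{n\to\infty}\frac1n|A\cap\{0,\dots,n-1\}|$. A sequence $\{x_i\}_{i=0}^\infty\subset X$ is a $\delta$-ergodic pseudo-orbit of $f$ if $\lim_{n\to\infty}\frac1n|\{0\le i<n: d(f(x_i),x_{i+1})\ge\delta\}|=0$. $(X,f)$ has the $\overline{d}$-shadowing property if for every $\varepsilon>0$ there is $\delta>0$ such that for every $\delta$-ergodic pseudo-orbit $\{x_i\}_{i=0}^\infty$ there is $z\in X$ with $\overline{d}(\{i\in\mathbb{N}_0: d(f^i(z),x_i)<\varepsilon\})>1/2$. *)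

(* Defs.v *)
From HB Require Import structures.
From mathcomp Require Import all_boot all_order all_algebra.
From mathcomp Require Import all_classical all_reals all_analysis.

Set Implicit Arguments.
Unset Strict Implicit.
Unset Printing Implicit Defensive.

Import Order.TTheory GRing.Theory Num.Theory.
Import numFieldNormedType.Exports.

Local Open Scope classical_set_scope.
Local Open Scope ring_scope.

(* At n = 0 the value is 0 / 0 = 0, which does not affect limits in n. *)
Definition frequency (R : realType) (A : set nat) (n : nat) : R :=
  #|[pred i : 'I_n | `[< A i >]]|%:R / n%:R.

(* The frequencies lie in [0, 1], so the real-valued limsup is well defined. *)
Definition upper_density (R : realType) (A : set nat) : R :=
  limn_sup (frequency R A).

Definition dynamical_system (R : realType) (X : metricType R) (f : X -> X) :
  Prop := compact [set: X] /\ continuous f.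

Definition nontrivial (X : Type) : Prop := exists x y : X, x <> y.

(* Metric equicontinuity of the iterates, with delta uniform in the point;
   the library's [equicontinuous] is the pointwise topological notion. *)
Definition equicontinuous_map (R : realType) (X : metricType R) (f : X -> X) :
  Prop :=
  forall eps : R, 0 < eps -> exists2 delta : R, 0 < delta &
    forall x y : X, mdist x y < delta ->
      forall n : nat, mdist (iter n f x) (iter n f y) < eps.

Definition ergodic_pseudo_orbit (R : realType) (X : metricType R) (f : X -> X)
    (delta : R) (x : nat -> X) : Prop :=
  frequency R [set i | delta <= mdist (f (x i)) (x i.+1)] @ \oo --> (0 : R).

Definition dbar_shadowing (R : realType) (X : metricType R) (f : X -> X) :
  Prop :=
  forall eps : R, 0 < eps -> exists2 delta : R, 0 < delta &
    forall x : nat -> X, ergodic_pseudo_orbit f delta x ->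
      exists z : X,
        upper_density R [set i | mdist (iter i f z) (x i) < eps] > 2^-1.

(* Main.v *)
Require Import Defs.
From mathcomp Require Import all_boot all_order all_algebra.
From mathcomp Require Import all_classical all_reals all_analysis.
From mathcomp Require Import zify lra.

(** A surjective equicontinuous map of a compact metric space contracts no
distance substantially, uniformly in time: if two orbits are close at some
time [i], their starting points are close, with a modulus independent of [i]
([equicontinuous_backward]).  So an orbit that approaches the orbit of [p] at
one time and the orbit of [q] at another time starts close to both [p] and
[q], which is impossible when [p <> q] and the scale is fine enough.

The pseudo-orbit defeating shadowing switches between the orbits of [p] and
[q]: it follows [p] on the time blocks [k^2, (k+1)^2) with [k] even and [q] on
those with [k] odd.  The block lengths tend to infinity, so the jumps, one at
the end of each block, have density zero ([sum_block_changes]); they also grow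
slowly enough that each of the two sets of times has density exactly 1/2
([sum_block_parity]).  An orbit within [eps] of the pseudo-orbit can only be so
at times of one of the two kinds, hence on a set of upper density at most 1/2,
whereas shadowing asks for strictly more. *)

Set Implicit Arguments.
Unset Strict Implicit.
Unset Printing Implicit Defensive.

Import Order.TTheory GRing.Theory Num.Theory.
Import numFieldNormedType.Exports.

Local Open Scope classical_set_scope.
Local Open Scope ring_scope.

(** Two sequences are handled at once because a return time common to two
points is needed below; a cluster point of the sequence of pairs, in the compact
square, provides it. *)
Lemma compact_close_pairs (R : realType) (X : metricType R)
    (cptX : compact [set: X]) (u v : nat -> X) (d : R) : 0 < d ->
  exists n m, [/\ (n < m)%N, mdist (u n) (u m) < d & mdist (v n) (v m) < d].
Proof.
move=> d0; have cptXX := compact_setX cptX cptX; rewrite setXTT in cptXX.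
have [[a b] [_ abF]] := cptXX ((fun n => (u n, v n)) @ \oo) _ filterT.
have d20 : 0 < d / 2 by rewrite divr_gt0.
have nbhs_ab : nbhs (a, b) (ball a (d / 2) `*` ball b (d / 2)).
  by exists (ball a (d / 2), ball b (d / 2)) => //; split; exact: nbhsx_ballx.
have return_after N : exists2 n, (N <= n)%N &
    mdist a (u n) < d / 2 /\ mdist b (v n) < d / 2.
  have FN : ((fun n => (u n, v n)) @ \oo)
      [set w | exists2 n, (N <= n)%N & w = (u n, v n)].
    by exists N => // n /= Nn; exists n.
  have [w [[n Nn ->] [/= ua vb]]] := abF _ _ FN nbhs_ab.
  by exists n => //; move: ua vb; rewrite !ballEmdist.
have close (c x y : X) :
    mdist c x < d / 2 -> mdist c y < d / 2 -> mdist x y < d.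
  move=> cx cy; have := metric_triangle x c y.
  by rewrite (metric_sym x c); lra.
have [n _ [an bn]] := return_after 0.
have [m nm [am bm]] := return_after n.+1.
by exists n, m; split; [| exact: close an am | exact: close bn bm].
Qed.

Lemma iter_cancel (X : Type) (f g : X -> X) : cancel g f ->
  forall m k x, iter (m + k) f (iter m g x) = iter k f x.
Proof.
move=> gK; elim=> [//|m IHm] k x.
by rewrite addSn iterSr iterS gK IHm.
Qed.

(** Both [x] and [y] almost return at a common time [k >= i]: among the pasts of
[(x, y)] two are close, and pushing them forward until the older one reaches
[(x, y)] turns the gap between them into a return time, the closeness
surviving by equicontinuity.  If the orbits of [x] and [y] are close at time
[i], they remain so up to time [k], when they are back near [x] and [y]. *)
Lemma equicontinuous_backward (R : realType) (X : metricType R) (f : X -> X) :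
    compact [set: X] -> set_surj [set: X] [set: X] f ->
    equicontinuous_map f ->
  forall eta : R, 0 < eta -> exists2 eps : R, 0 < eps &
    forall (i : nat) (x y : X),
      mdist (iter i f x) (iter i f y) < eps -> mdist x y < eta.
Proof.
move=> cptX f_surj f_equi eta eta0.
have [g gK] : exists g, cancel g f.
  have /choice[g fgE] (y : X) : exists x, f x = y.
    by have [x _ <-] := f_surj y I; exists x.
  by exists g.
have eta30 : 0 < eta / 3 by rewrite divr_gt0.
have [delta delta0 f_delta] := f_equi _ eta30.
exists delta => // i x y xy_close.
(* Sampling the pasts at multiples of [i.+1] makes every gap at least [i]. *)
have [n [m [ltnm xnm ynm]]] := compact_close_pairs cptX
  (fun n => iter (n * i.+1) g x) (fun n => iter (n * i.+1) g y) delta0.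
pose k := ((m - n) * i.+1)%N.
have mE : (m * i.+1 = n * i.+1 + k)%N by rewrite /k -mulnDl subnKC // ltnW.
have return_close z :
    mdist (iter (n * i.+1) g z) (iter (m * i.+1) g z) < delta ->
    mdist (iter k f z) z < eta / 3.
  move=> /f_delta/(_ (m * i.+1)%N); rewrite {1}mE iter_cancel //.
  by rewrite -{1}[(m * i.+1)%N]addn0 iter_cancel.
have lik : (i <= k)%N by rewrite /k; nia.
have kE : k = (k - i + i)%N by rewrite subnK.
have := f_delta _ _ xy_close (k - i)%N; rewrite -!iterD -kE => kxy.
have := return_close _ xnm; have := return_close _ ynm.
have := metric_triangle x (iter k f x) y.
have := metric_triangle (iter k f x) (iter k f y) y.
by rewrite (metric_sym x (iter k f x)); lra.
Qed.

(** The pair of [k] and [n - k ^ 2], where [k] is the integer square root of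
[n]; the recursion makes the counts below provable by induction on [n]. *)
Fixpoint square_block (n : nat) : nat * nat :=
  if n is m.+1 then
    let: (k, r) := square_block m in
    if (r < k.*2)%N then (k, r.+1) else (k.+1, 0)
  else (0, 0).

Notation block n := (square_block n).1.
Notation offset n := (square_block n).2.

Lemma square_blockE n :
  (block n ^ 2 + offset n = n)%N /\ (offset n <= (block n).*2)%N.
Proof.
elim: n => [//|n] /=; case: (square_block n) => k r /= [].
by case: ltnP => /=; nia.
Qed.

Lemma sum_block_changes n :
  (\sum_(i < n) (odd (block i) != odd (block i.+1)) = block n)%N.
Proof.
elim: n => [|n IHn]; first by rewrite big_ord0.
rewrite big_ord_recr IHn /=; case: (square_block n) => k r /=.
by case: ltnP => _ /=; rewrite ?eqxx ?addn0 //; case: (odd k); rewrite addn1.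
Qed.

(** The blocks have lengths 1, 3, 5, ..., whose alternating partial sums are
[k] up to sign, so the surplus of one parity over the other runs linearly
from [- k] to [k + 1] along the block [k]: after [r] of its terms it
is [r - k] in favour of the parity of [k]. *)
Lemma sum_block_parity b n :
  let s := (\sum_(i < n) (odd (block i) == b))%N in
  if odd (block n) == b then (s.*2 + block n = n + offset n)%N
  else (s.*2 + offset n = n + block n)%N.
Proof.
elim: n => [|n] /=; first by rewrite big_ord0; case: b.
rewrite big_ord_recr; move: (\sum_(i < n) _)%N => s /=.
case: (square_block n) (square_blockE n) => k r /= [_].
by case: ltnP => /=; case: (odd k); case: b => /=; lia.
Qed.

Lemma sum_block_parity_le b n :
  ((\sum_(i < n) (odd (block i) == b)).*2 <= n + block n)%N.
Proof.
have [_ +] := square_blockE n; have := sum_block_parity b n => /=.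
by case: (odd _ == b); lia.
Qed.

Lemma cvg_block_ratio (R : realType) :
  (fun n => (block n)%:R / n%:R : R) @ \oo --> (0 : R).
Proof.
apply/cvgrPdist_lt => e e0; near=> n.
(* As [block n ^ 2 <= n], the square of the ratio is at most [1 / n]. *)
have n0 : 0 < n%:R :> R by rewrite ltr0n; near: n; exact: nbhs_infty_gt.
rewrite sub0r normrN ger0_norm ?divr_ge0 // ltr_pdivrMr //.
rewrite -(@ltr_pXn2r _ 2) ?nnegrE ?mulr_ge0 // ?ltW // exprMn.
apply: (@le_lt_trans _ _ n%:R).
  by rewrite -natrX ler_nat; have [] := square_blockE n; lia.
rewrite (expr2 n%:R) mulrA ltr_pMl //.
rewrite -ltr_pdivrMl ?exprn_gt0 // mulr1.
by near: n; exact: nbhs_infty_gtr.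
Unshelve. all: by end_near. Qed.

Lemma frequency_ge0 (R : realType) (A : set nat) n : 0 <= frequency R A n.
Proof. by rewrite divr_ge0. Qed.

Lemma frequency_le_count (R : realType) (A : set nat) (c : pred nat) n :
    (forall i, A i -> c i) ->
  frequency R A n <= (\sum_(i < n) c i)%:R / n%:R.
Proof.
move=> Ac; rewrite /frequency ler_wpM2r // ler_nat.
rewrite -sum1_card big_mkcond leq_sum // => i _.
by rewrite inE; case: asboolP => // /Ac ->.
Qed.

(** The lower bound [0 <= u n] keeps the sequence of suprema convergent; without
it the real-valued [limn_sup] could be a meaningless default value. *)
Lemma limn_sup_le (R : realType) (u v : nat -> R) (l : R) :
    (forall n, 0 <= u n <= v n) -> v @ \oo --> l -> limn_sup u <= l.
Proof.
move=> uv vl.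
have /cvg_seq_bounded v_bnd : cvgn v by apply/cvg_ex; exists l.
have [M Mv] := bounded_fun_has_ubound v_bnd.
have u_ub : has_ubound (range u).
  exists M => _ [n _ <-]; have /andP[_ /le_trans] := uv n; apply.
  by apply: Mv; exists n.
have u_lb : has_lbound (range u).
  by exists 0 => _ [n _ <-]; have /andP[] := uv n.
apply/ler_addgt0Pr => e e0; apply: limr_le.
  by apply/cvg_ex; eexists; exact: cvg_sups_inf.
have /cvgrPdist_lt/(_ _ e0)[N _ Ne] := vl.
exists N => // n /= Nn; apply: ge_sup; first by exists (u n), n => /=.
move=> _ [m /= nm <-]; have /andP[_ um] := uv m.
have := Ne m (leq_trans Nn nm).
by rewrite /= ltr_distlC => /andP[_ /ltW]; apply: le_trans.
Qed.

Lemma upper_density_block_parity (R : realType) (A : set nat) (b : bool) :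
  (forall i, A i -> odd (block i) == b) -> upper_density R A <= 2^-1.
Proof.
move=> Ab; apply: (@limn_sup_le _ _
  (fun n => 2^-1 + 2^-1 * ((block n)%:R / n%:R))) => [n|].
  rewrite frequency_ge0 /=.
  apply: le_trans.
    exact: (frequency_le_count _ (c := fun i => odd (block i) == b) _ Ab).
  have [->|n0] := posnP n; first by rewrite big_ord0 mul0r addr_ge0.
  have := sum_block_parity_le b n; move: (\sum_(i < n) _)%N => s sn.
  have n0' : 0 < n%:R :> R by rewrite ltr0n.
  rewrite ler_pdivrMr // mulrDl -mulrA divfK ?gt_eqF //.
  by move: sn; rewrite -(ler_nat R) natrD -mul2n natrM; lra.
rewrite -[X in _ --> X]addr0 -[X in _ + X](mulr0 2^-1).
apply: cvgD; first exact: cvg_cst.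
by apply: cvgM; [exact: cvg_cst | exact: cvg_block_ratio].
Qed.

Theorem corollary7p11 (R : realType) (X : metricType R) (f : X -> X)
    (f_dyn : dynamical_system f) (f_surj : set_surj [set: X] [set: X] f)
    (X_nontrivial : nontrivial X) (f_equi : equicontinuous_map f) :
  ~ dbar_shadowing f.
Proof.
move=> f_shadow; have [cptX _] := f_dyn.
have [p [q /eqP pq]] := X_nontrivial.
have eta0 : 0 < mdist p q / 2 by rewrite divr_gt0 // mdist_gt0.
have [eps eps0 backward] := equicontinuous_backward cptX f_surj f_equi eta0.
have [delta delta0 shadow] := f_shadow _ eps0.
pose x i := iter i f (if odd (block i) then q else p).
have x_pseudo : ergodic_pseudo_orbit f delta x.
  rewrite /ergodic_pseudo_orbit.
  apply: (squeeze_cvgr _ (cvg_cst 0) (@cvg_block_ratio R)); near=> n.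
  rewrite frequency_ge0 /= -[in leRHS]sum_block_changes.
  apply: (@frequency_le_count _ _
    (fun i => odd (block i) != odd (block i.+1))) => i /=.
  (* Without a change of parity the next point is the image of the last. *)
  apply: contraTN => /eqP same; rewrite -ltNge /x -iterS -same.
  by rewrite mdistxx.
have [z z_tracks] := shadow x x_pseudo.
set T := [set i | _] in z_tracks.
have tracks_start i :
    T i -> mdist z (if odd (block i) then q else p) < mdist p q / 2.
  exact: backward.
(* All tracking times have one parity, read off from the side of [z]. *)
have [[b Tb]|no_b] := pselect (exists b, forall i, T i -> odd (block i) == b).
  by have := upper_density_block_parity R Tb; rewrite leNgt z_tracks.
apply: no_b; exists (mdist z q < mdist p q / 2) => i /tracks_start.
have := metric_triangle p z q; rewrite (metric_sym p z).
by case: (odd _); case: (ltP (mdist z q)) => //; lra.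
Unshelve. all: by end_near. Qed.
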